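(* Let $n\ge 2$ be an integer, let $Q=[w_0,\dots,w_{n-1}]$ be the canonical cycle basis matrix of order $n$, let $\Delta_n:=\min_{m,t\in\mathbb Z}\left|\frac{2\pi m}{n}-\frac{(2t+1)\pi}{4}\right|$, and set \[ \delta_n:=1-\frac{1}{2\cos^2\Delta_n}=\frac12-\frac12\tan^2\Delta_n . \] Let $\lambda_1,\dots,\lambda_{n-1}\in[-1,0]$ and let $\Lambda=\operatorname{diag}(1,\lambda_1,\dots,\lambda_{n-1})$. If \[ 1+\sum_{j=1}^{n-1}\lambda_j>\delta_n, \] then $P(\Lambda)=Q\Lambda Q^{\top}$ is symmetric and doubly stochastic. In particular, $\delta_n<\tfrac12$ if and only if $8\nmid n$, whereas $\delta_n=\tfrac12$ when $8\mid n$.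
   Context: A real square matrix is doubly stochastic if its entries are non-negative and all its row sums and column sums equal $1$. The canonical cycle basis matrix of order $n$ is the real orthogonal matrix $Q=[w_0,\dots,w_{n-1}]$ whose columns (with coordinates indexed by $0,\dots,n-1$) are $w_0=\mathbf 1/\sqrt n$, where $\mathbf 1$ is the all-ones vector, and, for $1\le j\le n-1$, $w_j(k)=\sqrt{\tfrac2n}\,\sin\!\big(\tfrac{2\pi jk}{n}+\tfrac{\pi}{4}\big)$ for $0\le k\le n-1$. *)

(* Defs.v *)
From HB Require Import structures.
From mathcomp Require Import all_boot all_order all_algebra.
From mathcomp Require Import boolp classical_sets reals trigo.
From mathcomp Require Import ring lra.

Set Implicit Arguments.
Unset Strict Implicit.
Unset Printing Implicit Defensive.

Import Order.TTheory GRing.Theory Num.Theory.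

Local Open Scope classical_set_scope.
Local Open Scope ring_scope.

Section Definitions.
Variable R : realType.

Definition symmetric_mx n (A : 'M[R]_n) : Prop := A^T = A.

Definition doubly_stochastic n (A : 'M[R]_n) : Prop :=
  [/\ forall i j, 0 <= A i j,
      forall i, \sum_(j < n) A i j = 1
    & forall j, \sum_(i < n) A i j = 1].

Definition cycle_vec (n j : nat) : 'cV[R]_n :=
  \col_(k < n)
    if j == 0%N then 1 / Num.sqrt n%:R
    else Num.sqrt (2 / n%:R) * sin (2 * pi * j%:R * k%:R / n%:R + pi / 4).

Definition cycle_basis (n : nat) : 'M[R]_n :=
  \matrix_(k < n, j < n) cycle_vec n j k 0.

(* Only the values of lambda at 1, ..., n-1 are used. *)
Definition spectrum_mx (n : nat) (lambda : nat -> R) : 'M[R]_n :=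
  diag_mx (\row_(j < n) if (j : nat) == 0%N then 1 else lambda j).

Definition cycle_P (n : nat) (lambda : nat -> R) : 'M[R]_n :=
  cycle_basis n *m spectrum_mx n lambda *m (cycle_basis n)^T.

Definition angle_dist (n : nat) (m t : int) : R :=
  `| 2 * pi * m%:~R / n%:R - (2 * t + 1)%:~R * pi / 4 |.

(* The infimum is attained, see Delta_is_min below. *)
Definition Delta (n : nat) : R :=
  inf [set x | exists m t : int, x = angle_dist n m t].

Definition delta (n : nat) : R := 1 - 1 / (2 * cos (Delta n) ^+ 2).

Lemma Delta_is_min (n : nat) : (0 < n)%N ->
  (exists m t : int, Delta n = angle_dist n m t) /\
  (forall m t : int, Delta n <= angle_dist n m t).
Proof.
move=> n_gt0.
have n_neq0 : n%:R != 0 :> R by rewrite pnatr_eq0 -lt0n.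
pose K (m t : int) : nat := absz (8 * m - (2 * t + 1) * n%:Z)%R.
have distE m t : angle_dist n m t = (K m t)%:R * (pi / (4 * n%:R)).
  have c_ge0 : 0 <= pi / (4 * n%:R) :> R.
    by rewrite divr_ge0 ?pi_ge0 ?mulr_ge0.
  rewrite /angle_dist /K natr_absz intr_norm.
  rewrite -[X in _ = _ * X](ger0_norm c_ge0) -normrM; congr `| _ |.
  by rewrite !(rmorphB, rmorphD, rmorphM) /=; field.
have exK : exists k, `[< exists m t, k = K m t >].
  by exists (K 0 0); apply/asboolP; exists 0, 0.
have [k /asboolP[m0 [t0 kE]] k_min] := ex_minnP exK.
have le0 m t : angle_dist n m0 t0 <= angle_dist n m t.
  rewrite !distE ler_wpM2r ?divr_ge0 ?pi_ge0 ?mulr_ge0 // ler_nat -kE.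
  by apply: k_min; apply/asboolP; exists m, t.
have lb0 : lbound [set x | exists m t : int, x = angle_dist n m t]
    (angle_dist n m0 t0) by move=> _ [m [t ->]].
suff -> : Delta n = angle_dist n m0 t0 by split=> //; exists m0, t0.
apply/le_anti/andP; split.
  by apply: ge_inf; [exists (angle_dist n m0 t0) | exists m0, t0].
by apply: lb_le_inf => //; exists (angle_dist n m0 t0), m0, t0.
Qed.

End Definitions.

(* Main.v *)
Require Import Defs.
From HB Require Import structures.
From mathcomp Require Import all_boot all_order all_algebra.
From mathcomp Require Import boolp classical_sets reals trigo.
From mathcomp Require Import ring lra.

Set Implicit Arguments.
Unset Strict Implicit.
Unset Printing Implicit Defensive.

Import Order.TTheory GRing.Theory Num.Theory.

Local Open Scope ring_scope.

(** Write [theta m = 2 pi m / n + pi / 4], so that [w_j k] is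
    [sqrt (2 / n) * sin (theta (j k))].  An entry of [P] is then
    [n^-1 + \sum_j lambda_j * (2 / n) * sin (theta (j k)) * sin (theta (j l))].

    Every [theta m] is a multiple of [2 pi / n] shifted by [pi / 4], so its
    distance to the zeros of the cosine is the distance of [2 pi m / n] to an
    odd multiple of [pi / 4], hence at least [Delta]; therefore
    [|sin (theta m)| <= cos Delta] ([norm_sin_phase_le]).  As [- lambda_j >= 0],
    the sum in the entry is at least
    [- (2 / n) * cos Delta ^ 2 * \sum_j (- lambda_j)], and the trace hypothesis
    says exactly that [\sum_j (- lambda_j) < 1 / (2 cos Delta ^ 2)]: the entry
    is positive ([cycle_P_ge0]).

    Rows sum to 1 because the constant vector is a fixed vector of [P], each
    [w_j] with [0 < j < n] having coordinates that sum to 0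
    ([sum_sin_phase]); columns follow by symmetry of [Q Lambda Q^T].

    Finally [delta = 1 / 2 - tan Delta ^ 2 / 2] is below [1 / 2] unless
    [Delta = 0], and [Delta = 0] asks for integers with
    [8 m = (2 t + 1) n], that is [8 %| n] ([Delta_eq0]). *)

Section CycleBasis.
Variables (R : realType) (n : nat).
Hypothesis n_gt0 : (0 < n)%N.

Let n_neq0 : n%:R != 0 :> R. Proof. by rewrite pnatr_eq0 -lt0n. Qed.

Lemma Delta_ge0 : 0 <= Delta R n.
Proof. by have [[m [t ->]] _] := Delta_is_min R n_gt0; exact: normr_ge0. Qed.

Lemma Delta_le_pi4 : Delta R n <= pi / 4.
Proof.
have [_ /(_ 0 0)/le_trans] := Delta_is_min R n_gt0; apply.
rewrite /angle_dist mulr0 mul0r sub0r normrN mul1r ger0_norm //.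
by rewrite divr_ge0 ?pi_ge0.
Qed.

Lemma cos_Delta_gt0 : 0 < cos (Delta R n).
Proof.
apply: cos_gt0_pihalf.
by have := Delta_ge0; have := Delta_le_pi4; have := pi_gt0 R; lra.
Qed.

(** After clearing denominators, [Delta = 0] reads [8 m = (2 t + 1) n], where
    the factor [2 t + 1] is coprime to 8. *)
Lemma Delta_eq0 : (Delta R n == 0) = (8 %| n)%N.
Proof.
have pi_neq0 : pi != 0 :> R by rewrite gt_eqF ?pi_gt0.
apply/eqP/idP => [D0|/dvdnP[q nE]].
  have [[m [t DE]] _] := Delta_is_min R n_gt0.
  have /eqP : angle_dist R n m t = 0 by rewrite -DE.
  rewrite /angle_dist normr_eq0 subr_eq0 => /eqP E.
  have mtE : 8 * m = (2 * t + 1) * n%:Z.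
    apply: (@intr_inj R); rewrite !rmorphM /=.
    have -> : 8%:~R * m%:~R = (2 * pi * m%:~R / n%:R) * (4 * n%:R / pi) :> R.
      by move: (pi : R) pi_neq0 => p p_neq0; field; rewrite n_neq0 p_neq0.
    by rewrite E; move: (pi : R) pi_neq0 => p p_neq0; field.
  have cop : coprimez 8 (2 * t + 1).
    change (coprimez (2 ^+ 3)%R (2 * t + 1)); apply: coprimezXl.
    by rewrite /coprimez mulrC gcdzMDl.
  have : (8 %| (2 * t + 1) * n%:Z)%Z by rewrite -mtE dvdz_mulr.
  by rewrite Gauss_dvdzr.
(* For [n = 8 q] the angle [2 pi q / n] is exactly [pi / 4]. *)
apply/eqP; rewrite eq_le Delta_ge0 andbT.
have [_ /(_ q%:Z 0)/le_trans] := Delta_is_min R n_gt0; apply.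
have q_neq0 : q%:R != 0 :> R.
  by move: n_neq0; rewrite nE natrM mulf_eq0 negb_or => /andP[].
rewrite /angle_dist nE (_ : _ - _ = 0) ?normr0 //.
by rewrite natrM -[q%:~R]/(q%:R) mulr0 add0r; field.
Qed.

Lemma delta_tan : delta R n = 1 / 2 - 1 / 2 * tan (Delta R n) ^+ 2.
Proof.
have c_neq0 : cos (Delta R n) != 0 by rewrite gt_eqF // cos_Delta_gt0.
have -> : tan (Delta R n) ^+ 2 = cos (Delta R n) ^- 2 - 1.
  by rewrite cos2_tan2 // addrC addKr.
by rewrite /delta; field.
Qed.

(** [tan] vanishes only at 0 on [[0, pi / 4]]. *)
Lemma tan_Delta_eq0 : (tan (Delta R n) == 0) = (Delta R n == 0).
Proof.
have c_neq0 : cos (Delta R n) != 0 by rewrite gt_eqF // cos_Delta_gt0.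
apply/idP/eqP => [|->]; last by rewrite /tan sin0 mul0r.
rewrite /tan mulf_eq0 invr_eq0 (negPf c_neq0) orbF => /eqP s0.
apply/eqP/contraT => D0; have: 0 < sin (Delta R n).
  apply: sin_gt0_pi; rewrite lt_def D0 Delta_ge0 /=.
  by have := Delta_le_pi4; have := pi_gt0 R; lra.
by rewrite s0 ltxx.
Qed.

Definition phase (m : nat) : R := 2 * pi * m%:R / n%:R + pi / 4.

Lemma norm_sinD_natpi (x : R) q : `|sin (x + pi *+ q)| = `|sin x|.
Proof.
elim: q => [|q IHq]; first by rewrite addr0.
by rewrite mulrSr addrA sinDpi normrN.
Qed.

(** Subtracting a multiple of [pi] brings the angle within [pi / 2] of
    [pi / 2], where [sin] is [cos] of the distance to [pi / 2] and decreases
    with that distance. *)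
Lemma norm_sin_phase_le m : `|sin (phase m)| <= cos (Delta R n).
Proof.
have pi0 := pi_gt0 R.
have phase_ge0 : 0 <= phase m.
  by rewrite addr_ge0 ?divr_ge0 ?mulr_ge0 ?pi_ge0.
have := truncn_itv (divr_ge0 phase_ge0 (ltW pi0)).
set q := Num.truncn _; rewrite ler_pdivlMr // ltr_pdivrMr // => /andP[q_le q_lt].
pose x := phase m - q%:R * pi.
have x_ge0 : 0 <= x by rewrite subr_ge0.
have x_lt : x < pi by rewrite ltrBlDl; rewrite -natr1 mulrDl mul1r in q_lt.
have -> : `|sin (phase m)| = cos `|x - pi / 2|.
  rewrite cos_norm cosBpihalf -[RHS]ger0_norm ?sin_ge0_pi ?x_ge0 ?ltW //.
  by rewrite -(norm_sinD_natpi x q) -mulr_natl subrK.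
(* The zeros of [cos] correspond to the multiples [(4 q + 1) pi / 4], whence
   the index [2 q]. *)
have D_le : Delta R n <= `|x - pi / 2|.
  have [_ /(_ m%:Z (2 * q%:Z))] := Delta_is_min R n_gt0.
  rewrite /angle_dist; congr (_ <= `|_|).
  by rewrite /x /phase !(rmorphD, rmorphM) /=; field.
have x_le : `|x - pi / 2| <= pi by rewrite ler_norml; lra.
rewrite leNgt ltr_cos ?in_itv /= ?normr_ge0 ?Delta_ge0 ?x_le -?leNgt //.
exact: le_trans x_le.
Qed.

(** Multiplied by [2 sin (pi j / n)], which is nonzero, the sum telescopes to
    the difference of two cosines at angles that differ by [2 pi j]. *)
Lemma sum_sin_phase j : (0 < j < n)%N -> \sum_(l < n) sin (phase (j * l)) = 0.
Proof.
case/andP=> j_gt0 j_lt.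
pose h : R := pi * j%:R / n%:R.
have s_gt0 : 0 < sin h.
  apply: sin_gt0_pi; rewrite divr_gt0 ?mulr_gt0 ?pi_gt0 ?ltr0n //=.
  by rewrite ltr_pdivrMr ?ltr0n // ltr_pM2l ?pi_gt0 // ltr_nat.
pose f (l : nat) : R := - cos (phase (j * l) - h).
have telE l : 2 * sin h * sin (phase (j * l)) = f l.+1 - f l.
  have -> : f l.+1 = - cos (phase (j * l) + h).
    by congr (- cos _); rewrite /phase /h mulnS natrD; field.
  by rewrite /f cosB cosD; ring.
have /mulfI : 2 * sin h != 0 by rewrite mulf_neq0 // gt_eqF.
apply; rewrite mulr0 big_distrr /=.
rewrite -(big_mkord xpredT (fun l => 2 * sin h * sin (phase (j * l)))).
under eq_bigr do rewrite telE.
rewrite telescope_sumr // /f muln0 opprK addrC; apply/eqP; rewrite subr_eq0.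
apply/eqP; rewrite -(periodicn (@cosD2pi R) j); congr cos.
by rewrite /phase natrM -mulr_natr -mulr_natl; field.
Qed.

Lemma cycle_PE lambda (k l : 'I_n) : cycle_P n lambda k l = n%:R^-1 +
  \sum_(1 <= j < n) lambda j * (2 / n%:R *
    (sin (phase (j * k)) * sin (phase (j * l)))).
Proof.
rewrite /cycle_P mxE.
pose F (j : nat) : R := cycle_vec R n j k 0 *
  (if j == 0%N then 1 else lambda j) * cycle_vec R n j l 0.
transitivity (\sum_(0 <= j < n) F j).
  rewrite big_mkord; apply: eq_bigr => j _; rewrite mul_mx_diag !mxE.
  by rewrite /F !mxE.
rewrite big_ltn //; congr (_ + _).
  by rewrite /F !mxE /= mulr1 !mul1r -invfM -expr2 sqr_sqrtr.
rewrite !big_nat; apply: eq_bigr => j /andP[j_gt0 _].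
have s2 : Num.sqrt (2 / n%:R) * Num.sqrt (2 / n%:R) = 2 / n%:R :> R.
  by rewrite -expr2 sqr_sqrtr // divr_ge0.
by rewrite /F !mxE gtn_eqF // -[in RHS]s2 /phase !natrM !mulrA; ring.
Qed.

Lemma cycle_P_sym lambda : symmetric_mx (cycle_P n lambda : 'M[R]_n).
Proof.
by rewrite /symmetric_mx /cycle_P !trmx_mul trmxK tr_diag_mx mulmxA.
Qed.

Lemma cycle_P_row_sum lambda (k : 'I_n) :
  \sum_(l < n) cycle_P n lambda k l = 1 :> R.
Proof.
under eq_bigr do rewrite cycle_PE.
rewrite big_split /= sumr_const card_ord -(mulr_natl n%:R^-1 n) divff //.
rewrite exchange_big big_nat big1 ?addr0 // => j j_itv.
by rewrite -!big_distrr /= sum_sin_phase // !mulr0.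
Qed.

(** Each product of sines is at most [cos Delta ^ 2]; the sign of [lambda j]
    turns this upper bound into a lower bound on the entry. *)
Lemma cycle_P_ge0 lambda (k l : 'I_n) :
  (forall j, (1 <= j < n)%N -> lambda j <= 0) ->
  1 + \sum_(1 <= j < n) lambda j > delta R n -> 0 <= cycle_P n lambda k l.
Proof.
move=> lambda_le0 trace_gt; set c := cos (Delta R n).
have c_gt0 : 0 < c := cos_Delta_gt0.
rewrite cycle_PE.
have bound : (\sum_(1 <= j < n) lambda j) * (2 / n%:R * c ^+ 2) <=
  \sum_(1 <= j < n) lambda j * (2 / n%:R *
    (sin (phase (j * k)) * sin (phase (j * l)))).
  rewrite big_distrl /= !big_nat; apply: ler_sum => j j_itv.
  rewrite ler_wnM2l ?lambda_le0 // ler_wpM2l ?divr_ge0 //.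
  apply: le_trans (ler_norm _) _; rewrite normrM expr2.
  by apply: ler_pM => //; exact: norm_sin_phase_le.
apply: le_trans (lerD (lexx _) bound).
have -> : n%:R^-1 + (\sum_(1 <= j < n) lambda j) * (2 / n%:R * c ^+ 2) =
    (1 + \sum_(1 <= j < n) lambda j - delta R n) * (2 * c ^+ 2 / n%:R).
  by rewrite /delta -/c; field; rewrite n_neq0 gt_eqF.
by rewrite mulr_ge0 ?divr_ge0 ?mulr_ge0 ?exprn_ge0 ?subr_ge0 ?(ltW c_gt0) // ltW.
Qed.

End CycleBasis.

Theorem theorem3 (R : realType) (n : nat) (hn : (2 <= n)%N) :
  [/\ delta R n = 1 / 2 - 1 / 2 * tan (Delta R n) ^+ 2,
      forall lambda : nat -> R,
        (forall j : nat, (1 <= j < n)%N -> -1 <= lambda j <= 0) ->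
        1 + \sum_(1 <= j < n) lambda j > delta R n ->
        symmetric_mx (cycle_P n lambda) /\
        doubly_stochastic (cycle_P n lambda),
      delta R n < 1 / 2 <-> ~ (8 %| n)%N
    & (8 %| n)%N -> delta R n = 1 / 2].
Proof.
have n_gt0 : (0 < n)%N by exact: ltnW.
split; first exact: delta_tan.
- move=> lambda lambda_itv trace_gt.
  have symP := @cycle_P_sym R n lambda.
  split=> //; split=> [i j|i|j]; [|exact: cycle_P_row_sum|].
    by apply: cycle_P_ge0 => // s /lambda_itv /andP[].
  rewrite -[RHS](cycle_P_row_sum n_gt0 lambda j).
  by apply: eq_bigr => i _; rewrite -[in LHS]symP mxE.
- rewrite delta_tan // -(Delta_eq0 R n_gt0) -(tan_Delta_eq0 R n_gt0).
  rewrite gtrBl pmulr_rgt0 ?divr_gt0 // lt_def sqrf_eq0 sqr_ge0 andbT.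
  by split=> /negP.
- move=> n8; rewrite delta_tan //.
  have /eqP -> : tan (Delta R n) == 0 by rewrite tan_Delta_eq0 // Delta_eq0.
  by rewrite expr0n mulr0 subr0.
Qed.
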